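(* Let $p$ be a real number and consider weighted Motzkin paths with step weights $\alpha_k=k+1$, $\beta_k=k+p$, $\gamma_k=0$ for $k\ge0$. Then, for every $k\ge0$, $$H_k(t)=\sec^p t\,\tan^k t,\qquad w(x,t)=\frac{\sec^p t}{1-x\tan t}.$$ Equivalently, for all $n,k\ge0$, $w_{n,k}=n!\,[t^n]\,\sec^p t\,\tan^k t$.
   Context: Weighted Motzkin paths: a path starts at height $0$, never goes below height $0$, and uses steps $k\to k+1$ of weight $\alpha_k$, $k\to k$ of weight $\gamma_k$, and $k+1\to k$ of weight $\beta_k$ (down-steps indexed by arrival height). The weight of a path is the product of its step weights (empty path: $1$), and $w_{n,k}$ is the total weight of all paths of length $n$ ending at height $k$. $H_k(t)=\sum_{n\ge0}w_{n,k}t^n/n!$ and $w(x,t)=\sum_{k\ge0}H_k(t)x^k$, as (formal) power series; $[t^n]$ denotes the Taylor coefficient of $t^n$ at $0$, and $\sec^p t$ is the branch equal to $1$ at $t=0$. *)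

(* Defs.v *)
From HB Require Import structures.
From mathcomp Require Import all_boot all_order all_algebra.
From mathcomp Require Import all_classical all_reals all_analysis.
Set Implicit Arguments.
Unset Strict Implicit.
Unset Printing Implicit Defensive.
Import Order.TTheory GRing.Theory Num.Theory.
Import numFieldNormedType.Exports.
Local Open Scope classical_set_scope.
Local Open Scope ring_scope.

(** * Formal power series *)

(* A record rather than [nat -> R] itself, so that its ring structure cannot be
   confused with the pointwise one on functions. *)
Record fps (R : Type) := Fps { fps_coef : nat -> R }.

HB.instance Definition _ (R : Type) := gen_eqMixin (fps R).
HB.instance Definition _ (R : Type) := gen_choiceMixin (fps R).

Lemma fpsP (R : Type) (a b : fps R) : fps_coef a =1 fps_coef b -> a = b.
Proof. by case: a b => [a] [b] /= /funext ->. Qed.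

Section FpsRing.
Variable R : comNzRingType.
Implicit Types a b c : fps R.

Definition fps_zero : fps R := Fps (fun _ => 0).
Definition fps_opp a : fps R := Fps (fun n => - fps_coef a n).
Definition fps_add a b : fps R := Fps (fun n => fps_coef a n + fps_coef b n).

Lemma fps_addA : associative fps_add.
Proof. by move=> a b c; apply: fpsP => n /=; rewrite addrA. Qed.
Lemma fps_addC : commutative fps_add.
Proof. by move=> a b; apply: fpsP => n /=; rewrite addrC. Qed.
Lemma fps_add0 : left_id fps_zero fps_add.
Proof. by move=> a; apply: fpsP => n /=; rewrite add0r. Qed.
Lemma fps_addN : left_inverse fps_zero fps_opp fps_add.
Proof. by move=> a; apply: fpsP => n /=; rewrite addNr. Qed.

HB.instance Definition _ :=
  GRing.isZmodule.Build (fps R) fps_addA fps_addC fps_add0 fps_addN.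

Definition fpsC (x : R) : fps R := Fps (fun n => if n == 0%N then x else 0).
Definition fpsX : fps R := Fps (fun n => (n == 1%N)%:R).
Definition fps_mul a b : fps R :=
  Fps (fun n => \sum_(i < n.+1) fps_coef a i * fps_coef b (n - i)).

Let trunc N a : {poly R} := \poly_(i < N) fps_coef a i.

Let mul_trunc N n a b : (n < N)%N ->
  fps_coef (fps_mul a b) n = (trunc N a * trunc N b)`_n.
Proof.
move=> nN; rewrite coefM /=; apply: eq_bigr => i _.
rewrite !coef_poly (leq_ltn_trans (leq_ord i) nN).
by rewrite (leq_ltn_trans (leq_subr _ _) nN).
Qed.

Lemma fps_mulC : commutative fps_mul.
Proof.
by move=> a b; apply: fpsP => n; rewrite !(mul_trunc _ _ (ltnSn n)) mulrC.
Qed.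

Lemma fps_mulA : associative fps_mul.
Proof.
move=> a b c; apply: fpsP => n.
have E d e f : fps_coef (fps_mul (fps_mul d e) f) n
    = (trunc n.+1 d * trunc n.+1 e * trunc n.+1 f)`_n.
  rewrite [RHS]coefM /=; apply: eq_bigr => i _.
  rewrite -(mul_trunc _ _ (ltn_ord i)) coef_poly.
  by rewrite ltnS leq_subr.
by rewrite fps_mulC !E mulrC mulrA.
Qed.

Lemma fps_mul1 : left_id (fpsC 1) fps_mul.
Proof.
move=> a; apply: fpsP => n /=; rewrite big_ord_recl /= mul1r subn0.
by rewrite big1 ?addr0 // => i _; rewrite mul0r.
Qed.

Lemma fps_mulDl : left_distributive fps_mul +%R.
Proof.
move=> a b c; apply: fpsP => n /=; rewrite -big_split /=.
by apply: eq_bigr => i _; rewrite mulrDl.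
Qed.

Lemma fps_one_neq0 : fpsC 1 != 0.
Proof.
by apply/eqP => /(congr1 (fun a => fps_coef a 0%N)) /= /eqP; rewrite oner_eq0.
Qed.

HB.instance Definition _ := GRing.Zmodule_isComNzRing.Build (fps R)
  fps_mulA fps_mulC fps_mul1 fps_mulDl fps_one_neq0.

Definition fps_unit : {pred fps R} := fun a => `[< exists b, b * a = 1 >].
Definition fps_inv a : fps R :=
  if pselect (exists b, b * a = 1) is left e then projT1 (cid e) else a.

Lemma fps_mulV : {in fps_unit, left_inverse 1 fps_inv *%R}.
Proof.
move=> a /asboolP ua; rewrite /fps_inv; case: pselect => // e.
exact: (projT2 (cid e)).
Qed.

Lemma fps_unitP a b : b * a = 1 -> a \in fps_unit.
Proof. by move=> ab; apply/asboolP; exists b. Qed.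

Lemma fps_inv_out : {in [predC fps_unit], fps_inv =1 id}.
Proof.
move=> a /negP ua; rewrite /fps_inv; case: pselect => // e.
by exfalso; apply: ua; apply/asboolP.
Qed.

HB.instance Definition _ := GRing.ComNzRing_hasMulInverse.Build (fps R)
  fps_mulV fps_unitP fps_inv_out.

End FpsRing.

Arguments fpsX {R}.

(** * Taylor expansions at 0 and trigonometric functions *)

Definition taylor_coef (R : realType) (f : R -> R) (n : nat) : R :=
  (f^`(n))%classic 0 / n`!%:R.

Definition taylor (R : realType) (f : R -> R) : fps R := Fps (taylor_coef f).

Definition sec (R : realType) (t : R) : R := (cos t)^-1.

(* Where cos t > 0, in particular near 0, this is exp (p * ln (sec t)): the
   branch of sec^p equal to 1 at 0.  Other values of t do not affect [taylor]. *)
Definition sec_pow (R : realType) (p t : R) : R := sec t `^ p.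

(** * Weighted Motzkin paths *)

Variant step := Up | Level | Down.

Definition step_code (s : step) : option bool :=
  match s with Up => Some true | Level => None | Down => Some false end.
Definition step_decode (c : option bool) : step :=
  match c with Some true => Up | None => Level | Some false => Down end.
Lemma step_codeK : cancel step_code step_decode. Proof. by case. Qed.
HB.instance Definition _ := Finite.copy step (can_type step_codeK).

(* [None] when the path started at height h goes below height 0. *)
Fixpoint path_end (h : nat) (s : seq step) : option nat :=
  match s with
  | [::] => Some h
  | Up :: s' => path_end h.+1 s'
  | Level :: s' => path_end h s'
  | Down :: s' => if h is h'.+1 then path_end h' s' else None
  end.

(* A down-step k+1 -> k has weight beta k.  The weight 0 of a path that goes
   below height 0 is a dummy value. *)
Fixpoint path_weight (R : pzRingType) (alpha beta gamma : nat -> R)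
    (h : nat) (s : seq step) : R :=
  match s with
  | [::] => 1
  | Up :: s' => alpha h * path_weight alpha beta gamma h.+1 s'
  | Level :: s' => gamma h * path_weight alpha beta gamma h s'
  | Down :: s' =>
      if h is h'.+1 then beta h' * path_weight alpha beta gamma h' s' else 0
  end.

Definition motzkin (R : pzRingType) (alpha beta gamma : nat -> R)
    (n k : nat) : R :=
  \sum_(s : n.-tuple step | path_end 0 s == Some k)
    path_weight alpha beta gamma 0 s.

(* [motzkin_col] is H_k(t) and [motzkin_gf] is w(x,t), the latter as an element
   of R[[t]][[x]]. *)
Definition motzkin_col (R : realType) (alpha beta gamma : nat -> R)
    (k : nat) : fps R :=
  Fps (fun n => motzkin alpha beta gamma n k / n`!%:R).

Definition motzkin_gf (R : realType) (alpha beta gamma : nat -> R) :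
    fps (fps R) :=
  Fps (motzkin_col alpha beta gamma).

(* Main.v *)
Require Import Defs.
From HB Require Import structures.
From mathcomp Require Import all_boot all_order all_algebra.
From mathcomp Require Import all_classical all_reals all_analysis.
From mathcomp Require Import ring.
Set Implicit Arguments.
Unset Strict Implicit.
Unset Printing Implicit Defensive.
Import Order.TTheory GRing.Theory Num.Theory.
Import numFieldNormedType.Exports.
Local Open Scope classical_set_scope.
Local Open Scope ring_scope.

(** The functions f_k = sec^p tan^k satisfy f_k' = (k + p) f_(k+1) + k f_(k-1),
because sec' = sec tan and tan' = 1 + tan^2.  The coefficients of this system
are the weights of the two ways in which a path of length n + 1 arrives at
height k: from k + 1 by a down-step of weight beta_k = k + p, or from k - 1 by
an up-step of weight alpha_(k-1) = k.  So the n-th derivatives f_k^(n)(0) obey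
the same recursion in n as the path weights w_(n,k), and both start from
f_k(0) = w_(0,k) = [k = 0].

To iterate derivatives exactly, the argument is carried by all functions
sec^p P(tan) with P a polynomial ([sec_tan]).  Differentiation acts on them, where
cos > 0, by the linear operator P |-> p X P + (1 + X^2) P' on polynomials
([sec_tan_op]), so every Taylor coefficient at 0 is a value at 0 of an iterate of
that operator ([taylor_coef_sec_tan]).  On the path side, the recursion on the last
step is [motzkin_fromSr], and [motzkin_sec_tan] puts the two sides together.

The product form of H_k requires in addition that the Taylor series of
sec^p tan^k be the product of those of sec^p and of k copies of tan
([taylor_sec_tanM]).  This follows from the product rule, formal on one side
([fps_derivM]) and polynomial on the other ([sec_tan_opM]).  The bivariate series is
then the geometric series with ratio x tan t ([fps_geometric]). *)

(** * Recursions for weighted Motzkin paths *)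

Lemma big_step (V : nmodType) (F : step -> V) :
  \sum_(x : step) F x = F Up + F Level + F Down.
Proof.
rewrite (bigD1 Up) //= (bigD1 Level) //= (bigD1 Down) //= big1 ?addr0 ?addrA //.
by case.
Qed.

Lemma big_tuple_cons (V : nmodType) (T : finType) (n : nat)
    (P : pred (seq T)) (F : seq T -> V) :
  \sum_(s : n.+1.-tuple T | P s) F s
    = \sum_x \sum_(s : n.-tuple T | P (x :: s)) F (x :: s).
Proof.
rewrite pair_big_dep /=.
rewrite (reindex (fun u : T * n.-tuple T => cons_tuple u.1 u.2)) //=.
exists (fun s => (thead s, [tuple of behead s])) => [[x s] _|s _] /=.
  by congr (_, _); apply: val_inj.
by rewrite [RHS]tuple_eta; apply: val_inj.
Qed.

Section Motzkin.
Variables (R : comNzRingType) (alpha beta gamma : nat -> R).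

(** The starting height must be free for a recursion on the first step. *)
Definition motzkin_from (h n k : nat) : R :=
  \sum_(s : n.-tuple step | path_end h s == Some k)
    path_weight alpha beta gamma h s.

Lemma motzkin_from0 h k : motzkin_from h 0 k = (h == k)%:R.
Proof.
rewrite /motzkin_from (eq_bigr (fun=> 1)) => [|s _]; last by rewrite tuple0.
rewrite (eq_bigl (fun=> h == k)) => [|s]; last by rewrite tuple0 /=.
case: eqP => _; last by rewrite big_pred0.
by rewrite sumr_const card_tuple expn0.
Qed.

Lemma motzkin_fromSl h n k : motzkin_from h n.+1 k =
  alpha h * motzkin_from h.+1 n k + gamma h * motzkin_from h n k
  + (if h is h'.+1 then beta h' * motzkin_from h' n k else 0).
Proof.
rewrite {1}/motzkin_from.
rewrite (big_tuple_cons n (fun s => path_end h s == Some k)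
           (path_weight alpha beta gamma h)) big_step /= -!mulr_sumr.
congr (_ + _); case: h => [|h] /=; first by rewrite big1.
by rewrite -mulr_sumr.
Qed.

(** Peeling off the last step, while paths are read from their first step: with
[motzkin_fromSl], path weights are the powers of the one-step transfer matrix,
and such a power can be multiplied by the matrix on either side. *)
Lemma motzkin_fromSr h n k : motzkin_from h n.+1 k =
  (if k is k'.+1 then motzkin_from h n k' * alpha k' else 0)
  + motzkin_from h n k * gamma k + motzkin_from h n k.+1 * beta k.
Proof.
elim: n h k => [|n IHn] h k.
  rewrite motzkin_fromSl !motzkin_from0; congr (_ + _ + _).
  - case: k => [|k]; first by rewrite mulr0.
    rewrite motzkin_from0 eqSS mulrC.
    by case: eqVneq => [->|_] //=; rewrite !(mul0r, mulr0).
  - by rewrite mulrC; case: eqVneq => [->|_] //=; rewrite !(mul0r, mulr0).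
  - case: h => [|h]; first by rewrite mul0r.
    rewrite motzkin_from0 eqSS mulrC.
    by case: eqVneq => [->|_] //=; rewrite !(mul0r, mulr0).
rewrite [LHS]motzkin_fromSl.
by case: h => [|h]; case: k => [|k];
  rewrite ![in LHS]IHn ![in RHS]motzkin_fromSl; ring.
Qed.

End Motzkin.

(** * Formal power series *)

Section FpsDerivation.
Variable R : comNzRingType.
Implicit Types a b : fps R.

Lemma coef_fpsM a b n :
  fps_coef (a * b) n = \sum_(i < n.+1) fps_coef a i * fps_coef b (n - i).
Proof. by []. Qed.

Lemma coef_fpsD a b n : fps_coef (a + b) n = fps_coef a n + fps_coef b n.
Proof. by []. Qed.

Definition fps_deriv a : fps R := Fps (fun n => fps_coef a n.+1 *+ n.+1).

Lemma fps_derivM a b : fps_deriv (a * b) = fps_deriv a * b + a * fps_deriv b.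
Proof.
apply: fpsP => n; rewrite coef_fpsD !coef_fpsM /=.
(* The factor n + 1 is split as i + (n + 1 - i) in the i-th term. *)
transitivity (\sum_(i < n.+2) fps_coef a i *+ i * fps_coef b (n.+1 - i)
    + \sum_(i < n.+2) fps_coef a i * (fps_coef b (n.+1 - i) *+ (n.+1 - i))).
  rewrite -big_split -sumrMnl /=; apply: eq_bigr => i _.
  by rewrite mulrnAl mulrnAr -mulrnDr subnKC // -ltnS.
congr (_ + _); first by rewrite big_ord_recl mulr0n mul0r add0r.
rewrite [LHS]big_ord_recr /= subnn mulr0n mulr0 addr0.
by apply: eq_bigr => i _; rewrite subSn // -ltnS.
Qed.

End FpsDerivation.

Section Geometric.
Variable A : comNzRingType.

Lemma coef_fpsXM (a : fps A) n :
  fps_coef (fpsX * a) n = if n is n'.+1 then fps_coef a n' else 0.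
Proof.
rewrite coef_fpsM big_ord_recl mul0r add0r.
case: n => [|n]; first by rewrite big_ord0.
rewrite big_ord_recl mul1r subSS subn0 big1 ?addr0 // => i _.
by rewrite mul0r.
Qed.

Lemma coef_fpsMC (a : fps A) (c : A) n :
  fps_coef (a * fpsC c) n = fps_coef a n * c.
Proof.
rewrite coef_fpsM big_ord_recr /= subnn big1 ?add0r // => i _.
by rewrite subn_eq0 leqNgt ltn_ord mulr0.
Qed.

(** The product telescopes.  It also serves, for c = 1, to show that
1 - x u is a unit. *)
Lemma fps_geometric_mul (c u : A) :
  Fps (fun k => c * u ^+ k) * (1 - fpsX * fpsC u) = fpsC c.
Proof.
apply: fpsP => n; rewrite mulrBr mulr1 mulrCA; case: n => [|n].
  rewrite -[LHS]/(_ - fps_coef (fpsX * (_ * fpsC u)) 0) coef_fpsXM.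
  by rewrite subr0 /= expr0 mulr1.
rewrite -[LHS]/(_ - fps_coef (fpsX * (_ * fpsC u)) n.+1) coef_fpsXM coef_fpsMC.
by rewrite /= -mulrA -exprSr subrr.
Qed.

End Geometric.

Lemma fps_geometric (A : comNzRingType) (c u : A) :
  Fps (fun k => c * u ^+ k) = fpsC c / (1 - fpsX * fpsC u).
Proof.
rewrite -(fps_geometric_mul c u) mulrK //; apply: fps_unitP.
exact: (fps_geometric_mul 1 u).
Qed.

(** * Taylor coefficients of polynomials in the tangent times a power of the secant *)

Section SecTan.
Variable R : realType.
Implicit Types (p q t : R) (P Q : {poly R}).

Definition sec_tan p P t : R := sec_pow p t * P.[tan t].

(** Conjugate of d/dt under P |-> sec^p P(tan); see [is_derive_sec_tan]. *)
Definition sec_tan_op p P : {poly R} :=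
  p *: ('X * P) + (1 + 'X^2) * P^`().

Lemma iter_sec_tan_op_linear p n (a : R) P Q :
  iter n (sec_tan_op p) (a *: P + Q)
    = a *: iter n (sec_tan_op p) P + iter n (sec_tan_op p) Q.
Proof.
elim: n => //= n ->; rewrite /sec_tan_op derivD derivZ -!mul_polyC; ring.
Qed.

(** The coefficients are beta_k and alpha_(k-1).  For k = 0 the truncated exponent
k.-1 is harmless: its monomial comes with the coefficient 0. *)
Lemma sec_tan_opXn p k :
  sec_tan_op p 'X^k = (k%:R + p) *: 'X^(k.+1) + k%:R *: 'X^(k.-1).
Proof.
rewrite /sec_tan_op derivXn -!mul_polyC polyCD polyCMn polyC1 -mulr_natl.
case: k => [|k]; first by rewrite !expr0; ring.
by rewrite succnK !exprS; ring.
Qed.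

Lemma sec_tan_opM p q P Q :
  sec_tan_op (p + q) (P * Q) = sec_tan_op p P * Q + P * sec_tan_op q Q.
Proof. by rewrite /sec_tan_op derivM -!mul_polyC polyCD; ring. Qed.

Lemma is_derive_sec_pow p t :
  0 < cos t -> is_derive t 1 (sec_pow p) (p * sec_pow p t * tan t).
Proof.
move=> ct; have ct0 : cos t != 0 by rewrite gt_eqF.
have st : 0 < sec t by rewrite invr_gt0.
have dsec : is_derive t 1 (@sec R) (- (cos t) ^- 2 *: - sin t).
  exact: is_deriveV.
have dpow := is_derive1_powR p st.
apply: (is_derive_eq (is_derive1_comp dpow dsec)).
rewrite powRB ?(gt_eqF st) ?implybT // powRr1 ?ltW //.
rewrite /sec_pow /sec /tan /GRing.scale /=.
by field.
Qed.

Lemma is_derive_sec_tan p P t : 0 < cos t ->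
  is_derive t 1 (sec_tan p P) (sec_tan p (sec_tan_op p P) t).
Proof.
move=> ct; have ct0 : cos t != 0 by rewrite gt_eqF.
have dsec := is_derive_sec_pow p ct.
have dpoly := is_derive1_comp (is_derive_poly P (tan t)) (is_derive_tan ct0).
apply: (is_derive_eq (is_deriveM dsec dpoly)); rewrite cos2_tan2 //.
by rewrite /sec_tan /sec_tan_op /GRing.scale /= !hornerE /=; ring.
Qed.

Lemma near_cos_gt0 t : 0 < cos t -> \forall u \near t, 0 < cos u.
Proof.
by move=> ct; exact: (cvgr_gt _ (@continuous_cos R t) _ ct).
Qed.

(** The identity has to be proved on the whole open set cos > 0, and not only
at 0, since the next derivative depends on values near the point. *)
Lemma derive1n_sec_tan p P n t : 0 < cos t ->
  (sec_tan p P)^`(n)%classic t = sec_tan p (iter n (sec_tan_op p) P) t.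
Proof.
elim: n t => // n IHn t ct.
set Q := iter n (sec_tan_op p) P.
rewrite derive1nS derive1E (near_eq_derive (g := sec_tan p Q)).
  by have [_ ->] := is_derive_sec_tan p Q ct.
by apply: filterS (near_cos_gt0 ct) => u; exact: IHn.
Qed.

Lemma taylor_coef_sec_tan p P n :
  taylor_coef (sec_tan p P) n = (iter n (sec_tan_op p) P).[0] / n`!%:R.
Proof.
rewrite /taylor_coef derive1n_sec_tan ?cos0 //.
by rewrite /sec_tan /sec_pow /sec cos0 invr1 powR1 mul1r tan0.
Qed.

Lemma fps_deriv_taylor_sec_tan p P :
  fps_deriv (taylor (sec_tan p P)) = taylor (sec_tan p (sec_tan_op p P)).
Proof.
apply: fpsP => n; rewrite /= !taylor_coef_sec_tan -iterSr factS natrM.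
rewrite -mulr_natr.
by field; rewrite nat1r !pnatr_eq0 -lt0n fact_gt0.
Qed.

(** Both sides have the same constant term P(0) Q(0) and, by the product rule,
their derivatives are sums of products of the same shape; induction on the
index of the coefficient then works for all P and Q at once. *)
Lemma taylor_sec_tanM p q P Q :
  taylor (sec_tan p P) * taylor (sec_tan q Q)
    = taylor (sec_tan (p + q) (P * Q)).
Proof.
apply: fpsP => n; elim: n P Q => [|n IHn] P Q.
  rewrite coef_fpsM big_ord1 /= !taylor_coef_sec_tan /=.
  by rewrite fact0 !divr1 hornerM.
have n1 : n.+1%:R != 0 :> R by rewrite pnatr_eq0.
apply: (mulIf n1); rewrite !mulr_natr.
rewrite -[LHS]/(fps_coef (fps_deriv (_ * _)) n).
rewrite -[RHS]/(fps_coef (fps_deriv (taylor _)) n).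
rewrite fps_derivM !fps_deriv_taylor_sec_tan coef_fpsD !IHn /=.
rewrite !taylor_coef_sec_tan -mulrDl -hornerD; congr (_.[0] / _).
rewrite sec_tan_opM -[sec_tan_op p P * Q]scale1r.
by rewrite iter_sec_tan_op_linear !scale1r.
Qed.

Lemma sec_powE p : sec_pow p = sec_tan p 1.
Proof. by apply/funext => t; rewrite /sec_tan hornerC mulr1. Qed.

Lemma tanE : @tan R = sec_tan 0 'X.
Proof.
by apply/funext => t; rewrite /sec_tan /sec_pow powRr0 hornerX mul1r.
Qed.

Lemma sec_pow_tanXE p k :
  (fun t => sec_pow p t * tan t ^+ k) = sec_tan p 'X^k.
Proof. by apply/funext => t; rewrite /sec_tan hornerXn. Qed.

Lemma taylor_sec_pow_tanX p k :
  taylor (fun t => sec_pow p t * tan t ^+ k)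
    = taylor (sec_pow p) * taylor (@tan R) ^+ k.
Proof.
elim: k => [|k IHk].
  by rewrite sec_pow_tanXE expr0 -sec_powE expr0 mulr1.
by rewrite exprSr mulrA -IHk !sec_pow_tanXE tanE taylor_sec_tanM addr0 -exprSr.
Qed.

(** The operator turns X^k into the combination of X^(k+1) and X^(k-1) prescribed
by the last step of a path ending at height k.  Applying it first, as [iterSr]
does, makes the remaining n iterations act on monomials, as the induction needs. *)
Lemma motzkin_sec_tan p n k :
  motzkin (fun k => k.+1%:R) (fun k => k%:R + p) (fun=> 0) n k
    = (iter n (sec_tan_op p) 'X^k).[0].
Proof.
rewrite -[LHS]/(motzkin_from _ _ _ 0 n k).
elim: n k => [|n IHn] k.
  by rewrite motzkin_from0 hornerXn expr0n eq_sym.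
rewrite motzkin_fromSr iterSr sec_tan_opXn.
(* The null summand gives both terms the shape a *: P + Q. *)
rewrite -[_ *: 'X^(k.-1)]addr0 !iter_sec_tan_op_linear.
have -> : iter n (sec_tan_op p) 0 = 0.
  by elim: n {IHn} => //= n ->; rewrite /sec_tan_op deriv0 !mulr0 scaler0 addr0.
rewrite addr0 hornerD !hornerZ -!IHn mulr0 addr0 addrC [in RHS]mulrC.
by congr (_ + _); case: k => [|k] /=; rewrite ?mul0r // mulrC.
Qed.

End SecTan.

Theorem corollary4p4 (R : realType) (p : R) :
  let alpha := fun k : nat => k.+1%:R : R in
  let beta := fun k : nat => k%:R + p : R in
  let gamma := fun _ : nat => 0 : R in
  [/\ forall k : nat, motzkin_col alpha beta gamma k
        = taylor (sec_pow p) * taylor (@tan R) ^+ k,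
      motzkin_gf alpha beta gamma
        = fpsC (taylor (sec_pow p)) / (1 - fpsX * fpsC (taylor (@tan R)))
    & forall n k : nat, motzkin alpha beta gamma n k
        = n`!%:R * taylor_coef (fun t : R => sec_pow p t * tan t ^+ k) n].
Proof.
move=> alpha beta gamma.
have coefE n k : motzkin alpha beta gamma n k
    = n`!%:R * taylor_coef (fun t : R => sec_pow p t * tan t ^+ k) n.
  rewrite sec_pow_tanXE taylor_coef_sec_tan motzkin_sec_tan mulrC.
  by rewrite divfK.
have colE k : motzkin_col alpha beta gamma k
    = taylor (sec_pow p) * taylor (@tan R) ^+ k.
  rewrite -taylor_sec_pow_tanX; apply: fpsP => n /=.
  by rewrite coefE mulrC mulKf.
split => //.
by rewrite -fps_geometric; apply: fpsP => k; exact: colE.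
Qed.
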